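(* Let $\mathcal I=(I_n)_{n\ge 1}$ be an $\mathrm{Inc}$-invariant chain of eventually nonzero edge ideals with stability index $\mathrm{ind}(\mathcal I)=r\ge 1$. Let $G_n$ be the graph corresponding to $I_n$. Then for all $n\ge 3r$, the graph $G_n$ does not contain any induced $3K_2$ subgraph; in other words, $\operatorname{indmatch}(G_n)\le 2$ for all $n\ge 3r$. Furthermore, $\operatorname{indmatch}(G_n)=\operatorname{indmatch}(G_{n+1})$ for all $n\ge 3r$.
   Context: Let $\Bbbk$ be a field, $R_n=\Bbbk[x_1,\ldots,x_n]$, $R=\bigcup_{n\ge 1}R_n$, and $\mathbb N$ the set of positive integers. $\mathrm{Inc}$ is the monoid of strictly increasing functions $\pi:\mathbb N\to\mathbb N$ under composition, acting on $R$ by $\Bbbk$-algebra endomorphisms via $\pi(x_i)=x_{\pi(i)}$. A family $\mathcal I=(I_n)_{n\ge 1}$ of ideals $I_n\subseteq R_n$ is an $\mathrm{Inc}$-invariant chain if $\pi(I_m)\subseteq I_n$ for all $1\le m<n$ and all $\pi\in\mathrm{Inc}$ with $\pi(m)\le n$. For $m\le n$ put $\mathrm{Inc}_{m,n}=\{\pi\in\mathrm{Inc}\mid \pi(m)\le n\}$. The stability index $\mathrm{ind}(\mathcal I)$ is the smallest $r\ge 1$ such that for all $n\ge r$, $I_n$ is the ideal of $R_n$ generated by $\mathrm{Inc}_{r,n}(I_r)=\{\pi(f):\pi\in \mathrm{Inc}_{r,n}, f\in I_r\}$ (such an $r$ always exists). An edge ideal is an ideal of $R_n$ generated by squarefree quadratic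 monomials; the corresponding graph $G_n$ on $[n]=\{1,\ldots,n\}$ has $\{i,j\}$ as an edge ($i\ne j$) iff $x_ix_j\in I_n$. A chain of eventually nonzero edge ideals is one in which each $I_n$ is an edge ideal and $I_n\neq 0$ for all $n\gg 0$. $gK_2$ is the graph consisting of $g$ pairwise disjoint edges, and $\operatorname{indmatch}(G)$ is the maximal $g$ such that $G$ has an induced $gK_2$ subgraph. *)

(* Defs.v *)
(* Mathematical Components, with multinomials and mathcomp-classical. *)
From mathcomp Require Import all_boot all_order all_algebra.
From mathcomp Require Import mpoly.
From mathcomp Require Import boolp classical_sets.

Set Implicit Arguments.
Unset Strict Implicit.
Unset Printing Implicit Defensive.

Import GRing.Theory.
Local Open Scope ring_scope.
Local Open Scope classical_set_scope.

Definition is_ideal (R : comNzRingType) (S : set R) : Prop :=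
  [/\ S 0, forall f g, S f -> S g -> S (f + g)
         & forall a f, S f -> S (a * f)].

Definition ideal_gen (R : comNzRingType) (S : set R) : set R :=
  [set f | exists d (a g : 'I_d -> R),
     (forall i, S (g i)) /\ f = \sum_(i < d) a i * g i].

(* Variables are numbered from 0: the index i : 'I_n stands for x_(i+1), and a
   function p : nat -> nat for the map i+1 |-> p(i)+1 on positive integers.
   For m >= 1 the condition "the value at m is at most n" therefore reads
   p m.-1 < n. *)
Definition is_inc (p : nat -> nat) : Prop := {homo p : i j / (i < j)%N}.

Definition Inc (m n : nat) : set (nat -> nat) :=
  [set p | is_inc p /\ (p m.-1 < n)%N].

(* For m >= 1 and p in Inc m n, p maps {0, ..., m-1} into {0, ..., n-1}; then
   this is the restriction to k[x_1, ..., x_m] of the action of p, which has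
   values in k[x_1, ..., x_n]. The value 0 for p i >= n is not used then. *)
Definition inc_act (k : fieldType) (m n : nat) (p : nat -> nat)
    (f : {mpoly k[m]}) : {mpoly k[n]} :=
  f \mPo [tuple (if insub (p i) is Some j then 'X_j else 0) | i < m].

(* Families are indexed by nat, but no condition is put on the term I 0. *)
Definition inc_chain (k : fieldType) (I : forall n, set {mpoly k[n]}) : Prop :=
  (forall n, (1 <= n)%N -> is_ideal (I n)) /\
  (forall m n p, (1 <= m < n)%N -> Inc m n p ->
     forall f, I m f -> I n (inc_act n p f)).

Definition stable_from (k : fieldType) (I : forall n, set {mpoly k[n]})
    (r : nat) : Prop :=
  forall n, (r <= n)%N ->
    I n = ideal_gen [set h | exists p f,
                       [/\ Inc r n p, I r f & h = inc_act n p f]].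

Definition is_stability_index (k : fieldType) (I : forall n, set {mpoly k[n]})
    (r : nat) : Prop :=
  [/\ (1 <= r)%N, stable_from I r
    & forall s, (1 <= s)%N -> stable_from I s -> (r <= s)%N].

Definition sqfree_quadratic_monomial (k : fieldType) (n : nat) :
    set {mpoly k[n]} :=
  [set f | exists i j : 'I_n, i != j /\ f = 'X_i * 'X_j].

(* The zero ideal is an edge ideal (take S empty). *)
Definition is_edge_ideal (k : fieldType) (n : nat) (J : set {mpoly k[n]}) :
    Prop :=
  exists S : set {mpoly k[n]},
    S `<=` @sqfree_quadratic_monomial k n /\ J = ideal_gen S.

Definition eventually_nonzero (k : fieldType)
    (I : forall n, set {mpoly k[n]}) : Prop :=
  exists N : nat, forall n, (N <= n)%N -> exists f, I n f /\ f != 0.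

Definition graph_of (k : fieldType) (n : nat) (J : set {mpoly k[n]}) :
    rel 'I_n :=
  fun i j => (i != j) && `[< J ('X_i * 'X_j) >].

(* gK_2 has vertices 'I_g * bool and edges {(a, false), (a, true)}. *)
Definition gK2 (g : nat) : rel ('I_g * bool) :=
  fun u v => (u.1 == v.1) && (u.2 != v.2).

Definition has_induced_gK2 (T : finType) (e : rel T) (g : nat) : bool :=
  [exists f : {ffun 'I_g * bool -> T},
     injectiveb f && [forall u, forall v, e (f u) (f v) == gK2 u v]].

(* An induced gK_2 has 2g vertices, so the bound g <= #|T| loses nothing. *)
Definition indmatch (T : finType) (e : rel T) : nat :=
  (\max_(g < #|T|.+1 | has_induced_gK2 e g) g)%N.

(* Main.v *)
(* An edge {x < y} of G_n, n >= r, is the image of an edge {i < j} of G_r under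
   an increasing map exactly when the numbers of vertices to the left of,
   between, and to the right of x and y are at least those for i and j, three
   numbers with sum r - 2. If two edges of an induced 2K_2 were nested or
   crossing, the non-adjacencies would bound the three gaps so that n < 3r; so
   they are separated, and then one lies in the first r vertices and the other
   in the last r. Three edges cannot be pairwise placed like this. Since the
   middle n - 2r >= r vertices play no role, inserting one more of them changes
   neither adjacency among the extreme vertices nor the induced matchings with
   at least two edges. *)
Require Import Defs.
From mathcomp Require Import all_boot all_order all_algebra.
From mathcomp Require Import mpoly.
From mathcomp Require Import boolp classical_sets.
From mathcomp Require Import zify.

Set Implicit Arguments.
Unset Strict Implicit.
Unset Printing Implicit Defensive.

(** * Induced matchings of finite relations *)

Section InducedMatchings.

Lemma has_induced_gK2P (T : finType) (e : rel T) (g : nat) :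
  reflect (exists f : 'I_g * bool -> T,
             injective f /\ forall u v, e (f u) (f v) = gK2 u v)
          (has_induced_gK2 e g).
Proof.
apply: (iffP existsP)
  => [[f /andP[/injectiveP inj_f /forallP fE]]|[f [inj_f fE]]].
  by exists f; split=> // u v; move/forallP: (fE u) => /(_ v)/eqP.
exists [ffun u => f u]; apply/andP; split.
  by apply/injectiveP => u v; rewrite !ffunE => /inj_f.
by apply/forallP => u; apply/forallP => v; rewrite !ffunE fE.
Qed.

Lemma has_induced_gK2_0 (T : finType) (e : rel T) : has_induced_gK2 e 0.
Proof.
have elim0 (A : Type) (u : 'I_0 * bool) : A by case: u => -[].
by apply/has_induced_gK2P; exists (elim0 T); split=> u; apply: elim0 u.
Qed.

Lemma has_induced_gK2_1 (T : finType) (e : rel T) (x y : T) :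
  irreflexive e -> ssrbool.symmetric e -> e x y -> has_induced_gK2 e 1.
Proof.
move=> irr_e sym_e exy; have neq_xy : x != y.
  by apply: contraTneq exy => ->; rewrite irr_e.
apply/has_induced_gK2P; exists (fun u => if u.2 then y else x).
split=> [[c b] [d b']|[c b] [d b']] /=; last first.
  by rewrite /gK2 (ord1 c) (ord1 d) eqxx; case: b b' => -[]; rewrite //= sym_e.
rewrite (ord1 c) (ord1 d).
by case: b b' => -[] // /eqP; rewrite ?(negPf neq_xy) 1?eq_sym ?(negPf neq_xy).
Qed.

Lemma has_induced_gK2_leq (T : finType) (e : rel T) (g h : nat) :
  g <= h -> has_induced_gK2 e h -> has_induced_gK2 e g.
Proof.
move=> le_gh /has_induced_gK2P[f [inj_f fE]]; apply/has_induced_gK2P.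
exists (fun u => f (widen_ord le_gh u.1, u.2)).
split=> [[c b] [d b'] /inj_f /= [/ord_inj -> ->] //|u v].
by rewrite fE.
Qed.

(** Dropping edges of an induced matching leaves an induced matching, so the sizes that occur form
    an initial segment and their maximum is a threshold. *)
Lemma leq_indmatch (T : finType) (e : rel T) (g : nat) :
  (g <= indmatch e) = has_induced_gK2 e g.
Proof.
apply/idP/idP => [le_g|has_g].
  apply: (has_induced_gK2_leq le_g).
  have A_gt0 : 0 < #|[pred i : 'I_#|T|.+1 | has_induced_gK2 e i]|.
    by apply/card_gt0P; exists ord0; apply: has_induced_gK2_0.
  have [i hi maxE] := eq_bigmax_cond (@nat_of_ord _) A_gt0.
  by rewrite /indmatch maxE.
have lt_g : g < #|T|.+1.
  have /has_induced_gK2P[f [inj_f _]] := has_g.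
  have := leq_card f inj_f; rewrite card_prod card_ord card_bool; lia.
exact: (leq_bigmax_cond (Ordinal lt_g) has_g).
Qed.

(** [A] will be the set of extreme vertices, on which passing between n and n+1 vertices preserves
    adjacency. *)
Lemma has_induced_gK2_transfer (T T' : finType) (e : rel T) (e' : rel T')
    (A : pred T) (s : T -> T') (g : nat) :
  {in A &, injective s} -> {in A &, forall x y, e' (s x) (s y) = e x y} ->
  (forall f : 'I_g * bool -> T, (forall u v, e (f u) (f v) = gK2 u v) ->
     forall u, f u \in A) ->
  has_induced_gK2 e g -> has_induced_gK2 e' g.
Proof.
move=> inj_s sE fA /has_induced_gK2P[f [inj_f fE]]; apply/has_induced_gK2P.
exists (s \o f); split=> [u v|u v] /=; last by rewrite sE ?fE ?(fA f).
by move/inj_s => /(_ (fA f fE u) (fA f fE v)) /inj_f.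
Qed.

End InducedMatchings.

(** * Graphs on n vertices spread from a relation on r vertices *)

Section Spread.
Variables (r : nat) (e : rel 'I_r).

(* For i < j < r, [box n i j x y] says that some p in [Inc r n] maps i to x and
   j to y; hence [adj n] is the adjacency of G_n when e is that of G_r. *)
Definition box n i j x y := [&& i <= x, j + x <= y + i & y + r <= n + j].

Definition spread n x y :=
  [exists i : 'I_r, exists j : 'I_r, [&& e i j, i < j & box n i j x y]].

Definition adj n x y := spread n x y || spread n y x.

Lemma spreadP n x y :
  reflect (exists i j : 'I_r, [/\ e i j, i < j & box n i j x y]) (spread n x y).
Proof.
apply: (iffP existsP) => [[i /existsP[j /and3P[? ? ?]]]|[i [j [? ? ?]]]].
  by exists i, j.
by exists i; apply/existsP; exists j; apply/and3P.
Qed.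

Lemma spread_apart n x y z w : 3 * r <= n -> spread n x y -> spread n z w ->
  x < z -> ~~ adj n x z -> ~~ adj n x w -> ~~ adj n y z -> ~~ adj n y w ->
  y < r /\ n <= z + r.
Proof.
move=> le_n /spreadP[i [j [eij ij bxy]]] /spreadP[i' [j' [eij' ij' bzw]]] xz.
have notin a b : ~~ adj n a b ->
    (~~ box n i j a b /\ ~~ box n i j b a) /\
    (~~ box n i' j' a b /\ ~~ box n i' j' b a).
  move=> /norP[/spreadP nab /spreadP nba].
  by split; split; apply/negP => bab;
     [apply: nab|apply: nba|apply: nab|apply: nba];
     [exists i, j|exists i, j|exists i', j'|exists i', j'].
move=> /notin[[n1 _] _] /notin[[n2 _] [n2' _]] /notin[[_ n3] [_ n3']].
move=> /notin[[_ n4] [n4' _]].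
have := ltn_ord j; have := ltn_ord j'.
move: bxy bzw n1 n2 n2' n3 n3' n4 n4'.
rewrite /box !negb_and -!ltnNge => /and3P[b1 b2 b3] /and3P[b1' b2' b3'].
have [yz|zy|yz] := ltngtP y z; last by lia.
  (* Separated: [x z] fails [box n i j] only on the right, so [n + j < z + r]; [y w] fails
     [box n i' j'] only on the left, so [y < i']. *)
  by move=> *; split; lia.
have [yw|wy|yw] := ltngtP y w; last by lia.
  (* Crossing, [x < z < y < w]: [x < i'], [z - x < j - i], [y - z < j - i], [w - y < j' - i'] and
     [n + j < w + r] force [n < 3 * r]. *)
  by move=> *; exfalso; lia.
(* Nested, [x < z < w < y]: [x < i'], [w - x < j - i], [y - w < j - i] and [n + j' < y + r] force
   [n < 3 * r]. *)
by move=> *; exfalso; lia.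
Qed.

Definition low x y := (x < r) && (y < r).
Definition high n x y := (n <= x + r) && (n <= y + r).

Lemma spread_lt n x y : spread n x y -> x < y.
Proof. by move=> /spreadP[i [j [_ ij]]]; rewrite /box; lia. Qed.

Lemma adjC n x y : adj n x y = adj n y x.
Proof. by rewrite /adj orbC. Qed.

Lemma adj_apart n x y z w : 3 * r <= n -> adj n x y -> adj n z w ->
  ~~ adj n x z -> ~~ adj n x w -> ~~ adj n y z -> ~~ adj n y w ->
  low x y && high n z w || low z w && high n x y.
Proof.
have lowC u v : low u v = low v u by rewrite /low andbC.
have highC u v : high n u v = high n v u by rewrite /high andbC.
move=> le_n; wlog sxy: x y / spread n x y => [H axy azw n1 n2 n3 n4|].
  have /orP[/H|/H] := axy; first exact.
  by rewrite adjC (lowC y) (highC y); apply.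
wlog szw: z w / spread n z w => [H axy azw n1 n2 n3 n4|].
  have /orP[/H|/H] := azw; first exact.
  by rewrite (adjC _ w) (lowC w) (highC w); apply.
move=> axy azw n1 n2 n3 n4.
have xy := spread_lt sxy; have zw := spread_lt szw.
have [xz|zx|xz] := ltngtP x z.
- have [] := spread_apart le_n sxy szw xz n1 n2 n3 n4; rewrite /low /high; lia.
- have [] := spread_apart le_n szw sxy zx; rewrite 1?adjC // /low /high; lia.
- by rewrite -xz adjC axy in n3.
Qed.

Lemma spread_self n i j : e i j -> i < j -> r <= n -> spread n i j.
Proof.
move=> eij ij rn; apply/spreadP; exists i, j; split=> //.
by rewrite /box leqnn addnC leqnn addnC leq_add2r.
Qed.

Definition extreme n x := (x < r) || (n <= x + r).
(** The value [r] is left out: the new vertex comes right after the low ones. *)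
Definition shift x := if x < r then x else x.+1.
Definition unshift x := if x < r then x else x.-1.

(** Each gap compared in [box] is either kept by [shift] or, as [3 * r <= n], so large that the
    comparison has the same outcome before and after. *)
Lemma adj_shift n : 3 * r <= n ->
  {in extreme n &, forall x y, adj n.+1 (shift x) (shift y) = adj n x y}.
Proof.
move=> le_n; have sE : {in extreme n &,
    forall x y, spread n.+1 (shift x) (shift y) = spread n x y}.
  move=> x y; rewrite /extreme !unfold_in => hx hy.
  apply: eq_existsb => i; apply: eq_existsb => j; congr [&& _, _ & _].
  have := ltn_ord i; have := ltn_ord j; rewrite /box /shift.
  by case: (ltnP x r) => ?; case: (ltnP y r) => ?; lia.
by move=> x y hx hy; rewrite /adj !sE.
Qed.

Lemma adj_irr n : irreflexive (adj n).
Proof.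
by move=> x; apply/negP => /orP[] /spread_lt; rewrite ltnn.
Qed.

Lemma adj_unshift n : 3 * r <= n ->
  {in extreme n.+1 &,
    forall x y, adj n (unshift x) (unshift y) = adj n.+1 x y}.
Proof.
move=> le_n.
have unshiftK x : x \in extreme n.+1 ->
    unshift x \in extreme n /\ shift (unshift x) = x.
  rewrite !unfold_in /extreme /shift /unshift.
  case: (ltnP x r) => [hx|hx] /=; first by rewrite hx.
  move=> hn; have -> : x.-1 < r = false by lia.
  split; lia.
move=> x y /unshiftK[hx xE] /unshiftK[hy yE].
by rewrite -(adj_shift le_n hx hy) xE yE.
Qed.

Section InducedInSpread.
Variables (n : nat) (en : rel 'I_n) (g : nat) (f : 'I_g * bool -> 'I_n).
Hypotheses (le_n : 3 * r <= n) (enE : forall u v, en u v = adj n u v).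
Hypothesis fE : forall u v, en (f u) (f v) = gK2 u v.

Lemma induced_apart c d (lo := fun c => low (f (c, false)) (f (c, true)))
    (hi := fun c => high n (f (c, false)) (f (c, true))) :
  c != d -> lo c && hi d || lo d && hi c.
Proof.
by move=> cd; apply: adj_apart => //; rewrite -enE fE /gK2 /= ?eqxx ?(negPf cd).
Qed.

(** No edge is both low and high, as that would give [n < 2 * r]; among three edges, two would lie
    at the same end. *)
Lemma induced_leq2 : g <= 2.
Proof.
rewrite leqNgt; apply/negP => g3.
pose o k (lt_k3 : k < 3) := Ordinal (leq_trans lt_k3 g3).
have apart k l (hk : k < 3) (hl : l < 3) : k != l -> _ :=
  @induced_apart (o k hk) (o l hl).
have := apart 0 1 isT isT isT; have := apart 0 2 isT isT isT.
have := apart 1 2 isT isT isT; rewrite /low /high; lia.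
Qed.

(** A lone edge may lie anywhere; with [2 <= g] another edge pushes it to one end. *)
Lemma induced_extreme u : 2 <= g -> f u \in [pred x : 'I_n | extreme n x].
Proof.
case: u => c b g2.
have [d cd] : exists d : 'I_g, c != d.
  have [c0|c0] := eqVneq (c : nat) 0.
    by exists (Ordinal g2); rewrite -val_eqE /= c0.
  by exists (Ordinal (ltnW g2)); rewrite -val_eqE.
have := induced_apart cd; rewrite inE /extreme /low /high.
by case: b; lia.
Qed.

End InducedInSpread.

Lemma has_induced_spreadS n (e1 : rel 'I_n) (e2 : rel 'I_n.+1) g :
  0 < r -> 3 * r <= n -> (forall u v, e1 u v = adj n u v) ->
  (forall u v, e2 u v = adj n.+1 u v) -> 2 <= g ->
  has_induced_gK2 e1 g = has_induced_gK2 e2 g.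
Proof.
move=> r_gt0 le_n e1E e2E g2; have le_n1 := leqW le_n.
apply/idP/idP.
  have s_lt (x : 'I_n) : shift x < n.+1.
    by have := ltn_ord x; rewrite /shift; case: ifP => _; lia.
  apply: (@has_induced_gK2_transfer _ _ _ _ [pred x : 'I_n | extreme n x]
            (fun x => Ordinal (s_lt x))) => [x y _ _ /(congr1 val) /=|x y hx hy|].
  - move=> sxy; apply/val_inj; move: sxy; rewrite /= /shift.
    by case: ltnP => ?; case: ltnP => ?; lia.
  - by rewrite e2E e1E adj_shift.
  - by move=> f fE u; apply: (induced_extreme le_n e1E fE).
(* [inord] needs a successor as bound; [0 < r] rules out [n = 0]. *)
case: n => [|n] in le_n le_n1 e1 e2 e1E e2E *; first by lia.
have s_lt (x : 'I_n.+2) : unshift x < n.+1.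
  by have := ltn_ord x; rewrite /unshift; case: (ltnP x r) => ?; lia.
apply: (@has_induced_gK2_transfer _ _ _ _ [pred x : 'I_n.+2 | extreme n.+2 x]
          (fun x => inord (unshift x))) => [x y hx hy /(congr1 val)|x y hx hy|].
- rewrite /= !inordK // => sxy; apply/val_inj; move: hx hy sxy.
  rewrite !inE /extreme /unshift /=.
  by case: (ltnP x r) => ?; case: (ltnP y r) => ? /=; lia.
- by rewrite e1E e2E !inordK // adj_unshift.
- by move=> f fE u; apply: (induced_extreme le_n1 e2E fE).
Qed.

End Spread.

(** * From edge ideals to graphs *)

Section EdgeIdeals.
Import GRing.Theory.
Local Open Scope ring_scope.

Lemma sub_ideal_gen (R : comNzRingType) (S : set R) f : S f -> ideal_gen S f.
Proof.
move=> Sf; exists 1%N, (fun=> 1), (fun=> f).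
by split=> //; rewrite big_ord1 mul1r.
Qed.

(** A morphism that kills all generators kills the ideal. Evaluations as [phi] locate monomial
    generators; the identity gives a nonzero generator. *)
Lemma ideal_gen_rmorph_neq0 (R R' : comNzRingType) (phi : {rmorphism R -> R'})
    (S : set R) f :
  ideal_gen S f -> phi f != 0 -> exists2 g, S g & phi g != 0.
Proof.
case=> d [a [g [Sg ->]]]; rewrite rmorph_sum.
case: (pickP (fun i => phi (g i) != 0)) => [i gi _|g0 /eqP[]].
  by exists (g i).
by apply: big1 => i _; rewrite rmorphM (eqP (negbFE (g0 i))) mulr0.
Qed.

Lemma graph_of_sym (k : fieldType) n (J : set {mpoly k[n]}) u v :
  graph_of J u v = graph_of J v u.
Proof. by rewrite /graph_of eq_sym mulrC. Qed.

Lemma is_inc_leq p i j : is_inc p -> (i <= j)%N -> (p i + j <= p j + i)%N.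
Proof.
move=> inc_p; elim: j => [|j IHj]; first by rewrite leqn0 => /eqP->.
rewrite leq_eqVlt => /predU1P[->//|/IHj].
by have := inc_p j j.+1 (ltnSn j); lia.
Qed.

Lemma inc_act_mulX (k : fieldType) m n (p : nat -> nat) (i j : 'I_m) (u v : 'I_n) :
  p i = u -> p j = v ->
  inc_act n p ('X_i * 'X_j : {mpoly k[m]}) = 'X_u * 'X_v.
Proof.
have insubE (a : 'I_n) : insub (a : nat) = Some a := valK a.
move=> pi pj; rewrite /inc_act rmorphM /= !comp_mpolyXU -!tnth_nth !tnth_mktuple.
by rewrite pi pj !insubE.
Qed.

Lemma box_Inc r n (i j : 'I_r) (x y : nat) : (0 < r)%N -> (i < j)%N ->
  box r n i j x y -> exists p, [/\ Inc r n p, p i = x & p j = y].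
Proof.
move=> r_gt0 ij bxy.
(* Three blocks of slope one; the inequalities of [box] give monotonicity at the junctions [i] and
   [j] and the bound at [r.-1]. *)
exists (fun t => if (t < i)%N then t else if (t < j)%N then (x + (t - i))%N
                 else (y + (t - j))%N).
rewrite /box in bxy; have := ltn_ord j.
split; [split=> [a b ab|]| |]; rewrite /= ?ltnn ?ij ?subnn ?addn0 //.
- by case: (ltnP a i) => ?; case: (ltnP b i) => ?; case: (ltnP a j) => ?;
     case: (ltnP b j) => ?; lia.
- by case: (ltnP r.-1 i) => ?; case: (ltnP r.-1 j) => ?; lia.
- by case: (ltnP j i) => ?; lia.
Qed.

Section Chain.
Variables (k : fieldType) (I : forall n, set {mpoly k[n]}) (r : nat).
Arguments I n : clear implicits.
Hypotheses (r_gt0 : (0 < r)%N) (stableI : stable_from I r).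
Hypothesis edgeI : is_edge_ideal (I r).

Lemma stable_graph_of n (u v : 'I_n) : (r <= n)%N ->
  graph_of (I n) u v = adj (graph_of (I r)) n u v.
Proof.
move=> le_rn; apply/idP/idP.
  case/andP=> uv /asboolP; rewrite (stableI le_rn) => Iuv.
  (* At the indicator [w] of u and v, ['X_u * 'X_v] takes the value 1, so some generator of [I n]
     does not vanish there. *)
  pose w := fun x : 'I_n => ((x == u) || (x == v))%:R : k.
  have wE x : w x != 0 -> (x == u) || (x == v).
    by rewrite /w; case: (_ || _) => //; rewrite eqxx.
  have [|_ [p [f [[inc_p p_n] If ->]]]] := ideal_gen_rmorph_neq0 (phi := meval w) Iuv.
    by rewrite /= mevalM !mevalXU /w !eqxx orbT mulr1 oner_eq0.
  (* [w'] is the pullback of [w] along [p], supported on indices sent to u or v; the default 0 of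
     [inc_act] evaluates to 0. *)
  rewrite /inc_act /= comp_mpoly_meval; set w' := (fun i => _).
  have w'E i : w' i != 0 -> (p i == u) || (p i == v).
    rewrite /w' tnth_mktuple; case: insubP => [x _ <-|]; last by rewrite meval0 eqxx.
    by rewrite mevalXU => /wE; rewrite -!val_eqE.
  have [S [subS IrE]] := edgeI; rewrite IrE in If.
  move=> /(ideal_gen_rmorph_neq0 (phi := meval w') If)[g Sg] /=.
  have := subS _ Sg; case=> i [j [ij gE]].
  rewrite gE mevalM !mevalXU mulf_eq0 => /norP[/w'E pi /w'E pj].
  have eij : graph_of (I r) i j.
    by rewrite /graph_of ij; apply/asboolP; rewrite -gE IrE; apply: sub_ideal_gen.
  wlog lt_ij : i j ij pi pj eij {gE} / (i < j)%N => [H|].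
    have := ij; rewrite -val_eqE neq_ltn => /orP[]; first exact: H.
    by apply: H => //; rewrite 1?eq_sym // graph_of_sym.
  have : spread (graph_of (I r)) n (p i) (p j).
    apply/spreadP; exists i, j; split=> //; apply/and3P.
    (* [p] shrinks none of the gaps in [0 <= i <= j <= r.-1]. *)
    have := is_inc_leq inc_p (leq0n i); have := is_inc_leq inc_p (ltnW lt_ij).
    have := @is_inc_leq _ j r.-1 inc_p; have := ltn_ord j.
    by split; lia.
  (* Since [p i < p j], these two values are u and v in some order. *)
  have := inc_p _ _ lt_ij; rewrite /adj.
  by case/orP: pi => /eqP->; case/orP: pj => /eqP->; rewrite ?ltnn // => _ ->; rewrite ?orbT.
wlog sp : u v / spread (graph_of (I r)) n u v => [H|].
  move=> auv; case/orP: (auv) => [/H|/H]; first exact.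
  by rewrite graph_of_sym adjC; apply.
move=> _; have uv := spread_lt sp.
rewrite /graph_of -val_eqE neq_ltn uv; apply/asboolP.
have /spreadP[i [j [/andP[_ /asboolP Iij] ij bij]]] := sp.
have [p [incp pi pj]] := box_Inc r_gt0 ij bij.
rewrite (stableI le_rn); apply: sub_ideal_gen.
by exists p, ('X_i * 'X_j); split=> //; rewrite (inc_act_mulX _ pi pj).
Qed.

(** For large n the nonzero ideal [I n] is generated by images of [I r], so [I r] is nonzero and has
    a monomial generator. *)
Lemma stable_graph_of_nonempty : eventually_nonzero I ->
  exists i j : 'I_r, (i < j)%N /\ graph_of (I r) i j.
Proof.
case=> N nzN; have [f []] := nzN _ (leq_maxl N r).
rewrite (stableI (leq_maxr N r)) => If f0.
have [_ [p [f' [_ If' ->]]] f'0] := ideal_gen_rmorph_neq0 (phi := idfun) If f0.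
have {}f'0 : f' != 0 by apply: contraNneq f'0 => ->; rewrite /= /inc_act rmorph0.
have [S [subS IrE]] := edgeI; rewrite IrE in If'.
have [g Sg _] := ideal_gen_rmorph_neq0 (phi := idfun) If' f'0.
have := subS _ Sg; case=> i [j [ij gE]].
have eij : graph_of (I r) i j.
  by rewrite /graph_of ij; apply/asboolP; rewrite -gE IrE; apply: sub_ideal_gen.
have := ij; rewrite -val_eqE neq_ltn => /orP[]; first by exists i, j.
by exists j, i; rewrite graph_of_sym.
Qed.

End Chain.
End EdgeIdeals.

Theorem theorem3p1 (k : fieldType) (I : forall n : nat, set {mpoly k[n]})
    (r : nat)
    (chainI : inc_chain I)
    (edgeI : forall n : nat, (1 <= n)%N -> is_edge_ideal (I n))
    (nzI : eventually_nonzero I)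
    (indI : is_stability_index I r) :
  (forall n : nat, (3 * r <= n)%N ->
     ~~ has_induced_gK2 (graph_of (I n)) 3 /\
     (indmatch (graph_of (I n)) <= 2)%N) /\
  (forall n : nat, (3 * r <= n)%N ->
     indmatch (graph_of (I n)) = indmatch (graph_of (I n.+1))).
Proof.
have [r_gt0 stableI _] := indI.
have graphE n (u v : 'I_n) : 3 * r <= n ->
    graph_of (I n) u v = adj (graph_of (I r)) n u v.
  by move=> le_n; apply: stable_graph_of => //; [apply: edgeI|lia].
have no3 n : 3 * r <= n -> ~~ has_induced_gK2 (graph_of (I n)) 3.
  move=> le_n; apply/negP => /has_induced_gK2P[f [_ fE]].
  by have := induced_leq2 le_n (fun u v => graphE n u v le_n) fE.
have has1 n : 3 * r <= n -> has_induced_gK2 (graph_of (I n)) 1.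
  move=> le_n; have [i [j [ij eij]]] := stable_graph_of_nonempty stableI (edgeI _ r_gt0) nzI.
  have le_rn : r <= n by lia.
  apply: (@has_induced_gK2_1 _ _ (widen_ord le_rn i) (widen_ord le_rn j)).
  - by move=> x; rewrite /graph_of eqxx.
  - by move=> x y; apply: graph_of_sym.
  - by rewrite graphE //; apply/orP; left; apply: spread_self.
split=> n le_n; first by split; rewrite ?no3 // leqNgt leq_indmatch no3.
have le_n1 := leqW le_n.
(* Two numbers with the same lower bounds [g] are equal. Sizes 0 and 1 are treated apart, since
   vertices are forced to the ends only for [2 <= g]. *)
suff hasE g : (g <= indmatch (graph_of (I n))) = (g <= indmatch (graph_of (I n.+1))).
  by apply/eqP; rewrite eqn_leq -hasE leqnn hasE leqnn.
rewrite !leq_indmatch; case: g => [|[|g]]; first by rewrite !has_induced_gK2_0.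
  by rewrite !has1.
exact: (has_induced_spreadS r_gt0 le_n (fun u v => graphE n u v le_n)
          (fun u v => graphE _ u v le_n1)).
Qed.
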